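(* For every symmetric probability measure $\mu$ on $\mathbb{R}$, $\Psi(\mu|\mathrm{b})\ge0$, and $\Psi(\mu|\mathrm{b})=0$ if and only if $\mu=\mathrm{b}$.
   Context: $\mathrm{b}=\frac12\delta_{-1}+\frac12\delta_{1}$ is the Rademacher distribution. For a symmetric probability measure $\mu$ on $\mathbb{R}$, the Boolean Fisher information of $\mu$ relative to $\mathrm{b}$ is $$\Psi(\mu|\mathrm{b})=\iint\frac{\log x^2-\log y^2}{x^2-y^2}\,d\mu(x)\,d\mu(y)+\int x^2\,d\mu(x)-2,$$ where the integrand of the double integral is understood with its continuous extension on the diagonal $x^2=y^2$ (value $1/x^2$, and $+\infty$ if $x=0$ or $y=0$); the value $+\infty$ is allowed. *)

(* Defs.v *)
From HB Require Import structures.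
From mathcomp Require Import all_boot all_order all_algebra.
From mathcomp Require Import all_classical all_reals all_analysis.
Set Implicit Arguments.
Unset Strict Implicit.
Unset Printing Implicit Defensive.
Import Order.TTheory GRing.Theory Num.Theory.
Import numFieldNormedType.Exports.
Local Open Scope classical_set_scope.
Local Open Scope ring_scope.

Section rademacher.
Variable R : realType.

Definition rademacher : set (measurableTypeR R) -> \bar R :=
  measure_add (mscale (2^-1)%:nng (\d_((-1)%R : measurableTypeR R)))
              (mscale (2^-1)%:nng (\d_(1%R : measurableTypeR R))).

HB.instance Definition _ := Measure.on rademacher.

Let rademacher_setT : rademacher setT = 1%E.
Proof.
rewrite /rademacher measure_addE; have d1 a := diracT R (a : measurableTypeR R).
rewrite [X in (X + _)%E](_ : _ = 2^-1%:E)%E; last first.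
  by rewrite -[RHS]mule1 -(d1 (-1)%R).
rewrite [X in (_ + X)%E](_ : _ = 2^-1%:E)%E; last first.
  by rewrite -[RHS]mule1 -(d1 1%R).
by rewrite -EFinD -[2^-1]mul1r -splitr.
Qed.

HB.instance Definition _ :=
  Measure_isProbability.Build _ _ R rademacher rademacher_setT.

End rademacher.
Arguments rademacher : clear implicits.

Definition symmetric_measure (R : realType)
    (mu : set (measurableTypeR R) -> \bar R) : Prop :=
  forall A : set (measurableTypeR R), measurable A ->
    pushforward mu (-%R : measurableTypeR R -> measurableTypeR R) A = mu A.

(* Since [ln 0 = 0] and [0^-1 = 0] in the library, the value [+oo] at the
   points where [x = 0] or [y = 0] has to be prescribed explicitly. *)
Definition boolean_fisher_kernel (R : realType) (x y : R) : \bar R :=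
  if (x == 0) || (y == 0) then +oo%E
  else if x ^+ 2 == y ^+ 2 then (1 / x ^+ 2)%:E
  else ((ln (x ^+ 2) - ln (y ^+ 2)) / (x ^+ 2 - y ^+ 2))%:E.

(* Both integrands are nonnegative, so the sum is never of the form
   [+oo + -oo]. *)
Definition boolean_fisher_info (R : realType)
    (mu : probability (measurableTypeR R) R) : \bar R :=
  (\int[mu \x mu]_z boolean_fisher_kernel z.1 z.2
   + \int[mu]_x (x ^+ 2)%:E - 2%:E)%E.

(* Main.v *)
(* The logarithmic mean is at most the arithmetic mean, so with [u = x^2] and
   [v = y^2] the kernel [K] satisfies [K + (u + v) / 2 >= 2], with equality
   only at [u = v = 1].  Distributing the second moment symmetrically over both
   variables, the information is the integral of the nonnegative gap
   [K + (u + v) / 2 - 2] against [mu \x mu]; it vanishes iff [mu] is carried by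
   [{-1, 1}], which for a symmetric [mu] forces the Rademacher law. *)
Require Import Defs.
From HB Require Import structures.
From mathcomp Require Import all_boot all_order all_algebra.
From mathcomp Require Import all_classical all_reals all_analysis.
From mathcomp Require Import measurable_realfun ring lra.
Import Order.TTheory GRing.Theory Num.Theory.
Import numFieldNormedType.Exports.
Local Open Scope classical_set_scope.
Local Open Scope ring_scope.

(** * The scalar logarithmic inequality *)

(* The derivative of [ln t - 2 t + t^2 / 2] is [(1 - t)^2 / t], which vanishes
   only at [1]. *)
Lemma ln_quadratic_lt_itv (R : realType) (s t : R) :
  0 < s -> s < t -> (t <= 1) || (1 <= s) ->
  ln s - 2 * s + s ^+ 2 / 2 < ln t - 2 * t + t ^+ 2 / 2.
Proof.
move=> s0 st h1.
pose h (x : R) := ln x - 2 * x + x ^+ 2 / 2.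
have dh (x : R) : 0 < x -> is_derive x 1 h (x^-1 - 2 + x).
  move=> x0; have dl := is_derive1_ln x0.
  rewrite /h; apply: is_derive_eq.
  rewrite /GRing.scale /=; lra.
have ch : {within `[s, t], continuous h}.
  apply: derivable_within_continuous => x; rewrite in_itv /= => /andP[sx _].
  have dhx := dh x (lt_le_trans s0 sx); exact: ex_derive.
have [|c] := MVT st _ ch (df := fun x => x^-1 - 2 + x).
  by move=> x; rewrite in_itv /= => /andP[sx _]; apply: dh; apply: lt_trans sx.
rewrite in_itv /= => /andP[sc ct] hE.
rewrite -subr_gt0 -/(h t) -/(h s) hE mulr_gt0 ?subr_gt0//.
have c0 := lt_trans s0 sc.
have -> : c^-1 - 2 + c = (1 - c) ^+ 2 / c by field; rewrite gt_eqF.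
rewrite divr_gt0// exprn_even_gt0//= subr_eq0.
case/orP: h1 => h1; first by rewrite gt_eqF// (lt_le_trans ct).
by rewrite lt_eqF// (le_lt_trans h1).
Qed.

(** The mean value theorem yields strictness only if its intermediate point avoids the critical
    point [1], so an interval with [1] in its interior is cut there. *)
Lemma ln_quadratic_lt (R : realType) (s t : R) : 0 < s -> s < t ->
  ln s - 2 * s + s ^+ 2 / 2 < ln t - 2 * t + t ^+ 2 / 2.
Proof.
move=> s0 st.
have [t1|t1] := leP t 1; first by apply: ln_quadratic_lt_itv; rewrite ?t1.
have [s1|s1] := leP 1 s; first by apply: ln_quadratic_lt_itv; rewrite ?s1 ?orbT.
by apply: (@lt_trans _ _ (ln 1 - 2 * 1 + 1 ^+ 2 / 2));
  apply: ln_quadratic_lt_itv; rewrite ?lexx ?orbT.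
Qed.

(** Since [(u^2 - v^2) / 2 = (u - v) (u + v) / 2], this is the strict monotonicity of
    [ln t - 2 t + t^2 / 2] divided by [u - v]. *)
Lemma ln_slope_gt (R : realType) (u v : R) : 0 < u -> 0 < v -> u != v ->
  2 - (u + v) / 2 < (ln u - ln v) / (u - v).
Proof.
wlog uv : u v / v < u => [H u0 v0 uv|u0 v0 _].
  (* Exchanging [u] and [v] flips the sign of both differences and preserves the quotient. *)
  have [vu|vu|E] := ltgtP u v; [|exact: H|by rewrite E eqxx in uv].
  rewrite -(opprB (ln v)) -(opprB v u) invrN mulrNN (addrC u).
  by apply: H => //; rewrite eq_sym.
rewrite ltr_pdivlMr ?subr_gt0//.
have := ln_quadratic_lt _ _ _ v0 uv.
lra.
Qed.

(** * The pointwise gap and its zeros *)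

Definition boolean_fisher_gap (R : realType) (x y : R) : \bar R :=
  (boolean_fisher_kernel x y + ((x ^+ 2 + y ^+ 2) / 2 - 2)%:E)%E.

(** With [u = x^2], the gap is [(1 - u)^2 / u] when [x^2 = y^2]; otherwise [ln_slope_gt] bounds it,
    or it is [+oo] when a coordinate is [0]. *)
Lemma boolean_fisher_gap_ge0 (R : realType) (x y : R) :
  (0 <= boolean_fisher_gap R x y)%E.
Proof.
rewrite /boolean_fisher_gap /boolean_fisher_kernel.
case: ifPn => [_|]; first by rewrite addye.
rewrite negb_or => /andP[x0 y0].
have x2 : 0 < x ^+ 2 by rewrite exprn_even_gt0.
have y2 : 0 < y ^+ 2 by rewrite exprn_even_gt0.
case: eqVneq => [<-|xy]; rewrite -EFinD lee_fin.
  have -> : 1 / x ^+ 2 + ((x ^+ 2 + x ^+ 2) / 2 - 2) = (1 - x ^+ 2) ^+ 2 / x ^+ 2.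
    by field.
  by rewrite divr_ge0 ?sqr_ge0.
have := ln_slope_gt _ _ _ x2 y2 xy; lra.
Qed.

(** The bound for [x^2 != y^2] is strict, so a zero forces [x^2 = y^2], and then
    [(1 - x^2)^2 / x^2 = 0]. *)
Lemma boolean_fisher_gap_eq0 (R : realType) (x y : R) :
  boolean_fisher_gap R x y = 0%E <-> x ^+ 2 = 1 /\ y ^+ 2 = 1.
Proof.
rewrite /boolean_fisher_gap /boolean_fisher_kernel; split.
  case: ifPn => [_|]; first by rewrite addye.
  rewrite negb_or => /andP[x0 y0].
  have x2 : 0 < x ^+ 2 by rewrite exprn_even_gt0.
  have y2 : 0 < y ^+ 2 by rewrite exprn_even_gt0.
  case: eqVneq => [<-|xy]; rewrite -EFinD => -[].
    have -> : 1 / x ^+ 2 + ((x ^+ 2 + x ^+ 2) / 2 - 2) = (1 - x ^+ 2) ^+ 2 / x ^+ 2.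
      by field.
    move=> /eqP; rewrite mulf_eq0 invr_eq0 (gt_eqF x2) orbF sqrf_eq0 subr_eq0.
    by move=> /eqP.
  have := ln_slope_gt _ _ _ x2 y2 xy; lra.
move=> [x1 y1].
have x0 : x != 0 by rewrite -sqrf_eq0 x1 oner_neq0.
have y0 : y != 0 by rewrite -sqrf_eq0 y1 oner_neq0.
rewrite (negbTE x0) (negbTE y0) /= x1 y1 eqxx -EFinD; congr EFin; lra.
Qed.

(** * Measurability of the kernel and the gap *)

Lemma measurable_funV d (T : measurableType d) (R : realType) (f : T -> R) :
  measurable_fun setT f -> measurable_fun setT (fun x => (f x)^-1).
Proof.
move=> mf.
(* [powR] is inversion on nonnegative reals, hence the detour by squares. *)
rewrite (_ : (fun x => _) = fun x => f x * ((f x ^+ 2) `^ (-1))).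
  apply: measurable_funM => //.
  by apply: (measurableT_comp (measurable_powR _)); exact: measurable_funX.
apply/funext => x; rewrite powR_inv1 ?sqr_ge0//.
(* At a zero of [f] both sides are [0], by the convention [0^-1 = 0]. *)
have [->|fx0] := eqVneq (f x) 0; first by rewrite invr0 mul0r.
by field.
Qed.

Lemma measurable_boolean_fisher_kernel (R : realType) :
  measurable_fun [set: measurableTypeR R * measurableTypeR R]
    (fun z => boolean_fisher_kernel z.1 z.2).
Proof.
have m1 : measurable_fun [set: measurableTypeR R * measurableTypeR R]
  (fun z => z.1 : R) by exact: measurable_fst.
have m2 : measurable_fun [set: measurableTypeR R * measurableTypeR R]
  (fun z => z.2 : R) by exact: measurable_snd.
have mX1 := measurable_funX 2 m1.
have mX2 := measurable_funX 2 m2.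
rewrite /boolean_fisher_kernel; apply: measurable_fun_ifT.
- by apply: measurable_or; exact: measurable_fun_eqr.
- exact: measurable_cst.
- apply: measurable_fun_ifT; first exact: measurable_fun_eqr.
    apply/measurable_EFinP; apply: measurable_funM => //; exact: measurable_funV.
  apply/measurable_EFinP; apply: measurable_funM.
    apply: measurable_funB.
      exact: (measurableT_comp (@measurable_ln R) mX1).
    exact: (measurableT_comp (@measurable_ln R) mX2).
  by apply: measurable_funV; exact: measurable_funB.
Qed.

Lemma measurable_boolean_fisher_gap (R : realType) :
  measurable_fun [set: measurableTypeR R * measurableTypeR R]
    (fun z => boolean_fisher_gap R z.1 z.2).
Proof.
apply: emeasurable_funD; first exact: measurable_boolean_fisher_kernel.
apply/measurable_EFinP; apply: measurable_funB => //.
apply: measurable_funM => //.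
by apply: measurable_funD; apply: measurable_funX;
  [exact: measurable_fst|exact: measurable_snd].
Qed.

(** * The information as an integral of the gap *)

Lemma boolean_fisher_kernel_ge0 (R : realType) (x y : R) :
  (0 <= boolean_fisher_kernel x y)%E.
Proof.
rewrite /boolean_fisher_kernel; case: ifPn => [//|].
rewrite negb_or => /andP[x0 y0].
have x2 : 0 < x ^+ 2 by rewrite exprn_even_gt0.
have y2 : 0 < y ^+ 2 by rewrite exprn_even_gt0.
case: eqVneq => [_|xy]; rewrite lee_fin; first by rewrite divr_ge0 ?sqr_ge0.
have [xy'|xy'|E] := ltgtP (x ^+ 2) (y ^+ 2); last by rewrite E eqxx in xy.
- by rewrite -(opprB (ln (y ^+ 2))) -(opprB (y ^+ 2)) invrN mulrNN divr_ge0//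
    subr_ge0 ?ler_ln ?ltW.
- by rewrite divr_ge0// subr_ge0 ?ler_ln ?ltW.
Qed.

(** The identity also covers infinite values: only nonnegative integrands are added, and only the
    finite constant [2] is cancelled. *)
Lemma boolean_fisher_infoE (R : realType)
    (mu : probability (measurableTypeR R) R) :
  boolean_fisher_info mu =
  (\int[mu \x mu]_z boolean_fisher_gap R z.1 z.2)%E.
Proof.
have mX : measurable_fun [set: measurableTypeR R] (fun x : R => (x ^+ 2)%:E).
  by apply/measurable_EFinP; exact: measurable_funX.
have mX1 : measurable_fun [set: measurableTypeR R * measurableTypeR R]
    (fun z => (z.1 ^+ 2)%:E).
  by apply: (measurableT_comp mX); exact: measurable_fst.
have mX2 : measurable_fun [set: measurableTypeR R * measurableTypeR R]
    (fun z => (z.2 ^+ 2)%:E).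
  by apply: (measurableT_comp mX); exact: measurable_snd.
(* By Tonelli, the variable absent from the integrand integrates out to the total mass [1]. *)
have int1 : (\int[mu \x mu]_z (z.1 ^+ 2)%:E = \int[mu]_x (x ^+ 2)%:E)%E.
  rewrite fubini_tonelli1//; last by move=> z; rewrite lee_fin sqr_ge0.
  apply: eq_integral => x _; rewrite /fubini_F /=.
  by rewrite integral_cst// [X in (_ * X)%E](probability_setT mu) mule1.
have int2 : (\int[mu \x mu]_z (z.2 ^+ 2)%:E = \int[mu]_x (x ^+ 2)%:E)%E.
  rewrite fubini_tonelli2//; last by move=> z; rewrite lee_fin sqr_ge0.
  apply: eq_integral => x _; rewrite /fubini_G /=.
  by rewrite integral_cst// [X in (_ * X)%E](probability_setT mu) mule1.
have int12 : (\int[mu \x mu]_z (2^-1%:E * (z.1 ^+ 2)%:E + 2^-1%:E * (z.2 ^+ 2)%:E)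
    = \int[mu]_x (x ^+ 2)%:E)%E.
  rewrite ge0_integralD//.
  - rewrite !ge0_integralZl// ?int1 ?int2; last first.
    + by move=> z _; rewrite lee_fin sqr_ge0.
    + by move=> z _; rewrite lee_fin sqr_ge0.
    rewrite -ge0_muleDl ?lee_fin ?invr_ge0//.
    by rewrite -EFinD -[2^-1]mul1r -splitr mul1e.
  - by move=> z _; rewrite -EFinM lee_fin mulr_ge0 ?invr_ge0 ?sqr_ge0.
  - exact: measurable_funeM.
  - by move=> z _; rewrite -EFinM lee_fin mulr_ge0 ?invr_ge0 ?sqr_ge0.
  - exact: measurable_funeM.
have int_cst : (\int[mu \x mu]_z 2%:E = 2%:E :> \bar R)%E.
  rewrite integral_cst//.
  by rewrite [X in (_ * X)%E](probability_setT (mu \x mu)%E) mule1.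
rewrite /boolean_fisher_info -int12 -ge0_integralD//; last 4 first.
- by move=> z _; exact: boolean_fisher_kernel_ge0.
- exact: measurable_boolean_fisher_kernel.
- by move=> z _; rewrite -!EFinM -EFinD lee_fin addr_ge0// mulr_ge0 ?sqr_ge0.
- by apply: emeasurable_funD; exact: measurable_funeM.
(* Writing the integrand as gap plus [2] keeps both summands nonnegative, so additivity applies
   without any integrability assumption. *)
transitivity (\int[mu \x mu]_z (boolean_fisher_gap R z.1 z.2 + 2%:E) - 2%:E)%E.
  congr (_ - _)%E; apply: eq_integral => z _.
  rewrite /boolean_fisher_gap -!EFinM -EFinD -addeA -EFinD.
  by congr (_ + _%:E)%E; lra.
rewrite ge0_integralD//.
- by rewrite int_cst addeK.
- by move=> z _; exact: boolean_fisher_gap_ge0.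
- exact: measurable_boolean_fisher_gap.
Qed.

(** * The equality case *)

Lemma measurable_sqr_eq1 (R : realType) :
  measurable ([set x | x ^+ 2 = 1] : set (measurableTypeR R)).
Proof.
rewrite (_ : [set _ | _] = setT `&` (fun x : R => x ^+ 2) @^-1` [set 1]).
  by apply: measurable_funX => //; exact: measurable_set1.
by rewrite setTI.
Qed.

(** A nonnegative function has integral zero iff it vanishes almost everywhere. The gap vanishes
    exactly on [E * E], whose complement has mass [1 - mu E * mu E]. *)
Lemma boolean_fisher_info_eq0 (R : realType)
    (mu : probability (measurableTypeR R) R) :
  boolean_fisher_info mu = 0%E <-> mu [set x : R | x ^+ 2 = 1] = 1%E.
Proof.
set E := [set x : R | x ^+ 2 = 1].
have mE : measurable (E : set (measurableTypeR R)) := measurable_sqr_eq1 R.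
have mEE : measurable (E `*` E : set (measurableTypeR R * measurableTypeR R)).
  exact: measurableX.
have muEE := product_measure1E mu mu mE mE.
rewrite boolean_fisher_infoE.
have -> : (\int[mu \x mu]_z boolean_fisher_gap R z.1 z.2
    = \int[mu \x mu]_z `|boolean_fisher_gap R z.1 z.2|)%E.
  by apply: eq_integral => z _; rewrite gee0_abs// boolean_fisher_gap_ge0.
rewrite ae_eq_integral_abs//; last exact: measurable_boolean_fisher_gap.
have -> : ae_eq (mu \x mu)%E setT
    (fun z => boolean_fisher_gap R z.1 z.2) (cst 0%E)
    <-> (mu \x mu)%E (~` (E `*` E)) = 0%E.
  rewrite -negligibleP; last exact: measurableC.
  rewrite (_ : E `*` E =
    [set z | setT z -> boolean_fisher_gap R z.1 z.2 = cst 0%E z])//.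
  apply/seteqP; split=> z /=; first by move=> ? _; exact/boolean_fisher_gap_eq0.
  by move/(_ I)/boolean_fisher_gap_eq0.
have -> : ((mu \x mu) (~` (E `*` E)) = 1 - mu E * mu E)%E.
  by rewrite probability_setC//; congr (_ - _)%E.
have muEfin : mu E \is a fin_num by exact: fin_num_measure.
have muE0 : (0 <= mu E)%E by exact: measure_ge0.
rewrite -(fineK muEfin); set e := fine _.
have e0 : 0 <= e by exact: fine_ge0.
rewrite -EFinM -EFinB; split=> -[] eE; congr EFin; last by rewrite eE mulr1 subrr.
(* What remains is [e^2 = 1], and [e >= 0] selects the root [1]. *)
apply/eqP; rewrite -(@pexpr_eq1 _ _ 2)// expr2.
by rewrite eq_sym -subr_eq0 eE.
Qed.

Lemma rademacherE (R : realType) (A : set (measurableTypeR R)) :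
  rademacher R A =
  (2^-1%:E * (\1_A (- 1 : R))%:E + 2^-1%:E * (\1_A (1 : R))%:E)%E.
Proof. by rewrite /rademacher measure_addE /mscale /= /dirac. Qed.

(** All mass sits on the two points [-1] and [1], which reflection exchanges; each therefore carries
    [1/2]. *)
Lemma symmetric_measure_sqr_eq1 (R : realType)
    (mu : probability (measurableTypeR R) R) : symmetric_measure mu ->
  mu [set x : R | x ^+ 2 = 1] = 1%E ->
  forall A : set (measurableTypeR R), measurable A -> mu A = rademacher R A.
Proof.
move=> smu; set E := [set x : R | x ^+ 2 = 1] => muE A mA.
have mE : measurable (E : set (measurableTypeR R)) := measurable_sqr_eq1 R.
have m1 (r : R) : measurable ([set r] : set (measurableTypeR R)).
  exact: measurable_set1.
have muN1 : mu [set -1 : R] = mu [set 1 : R].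
  rewrite -(smu [set 1 : R])// /pushforward; congr (mu _).
  by apply/seteqP; split=> x /=; [move=> ->; rewrite opprK|move=> <-; rewrite opprK].
have EE : E = [set -1 : R] `|` [set 1 : R].
  apply/seteqP; split=> x; rewrite /E /=.
    by move/eqP; rewrite sqrf_eq1 => /orP[] /eqP ->; [right|left].
  by case=> ->; rewrite ?sqrrN expr1n.
have disj : [set -1 : R] `&` [set 1 : R] = set0.
  by apply/seteqP; split=> x //= [->] /eqP; rewrite eqNr oner_eq0.
have mu1 : mu [set 1 : R] = 2^-1%:E.
  have mu1fin : mu [set 1 : R] \is a fin_num by exact: fin_num_measure.
  have : (mu [set 1%R : R] + mu [set 1%R : R] = 1)%E.
    by rewrite -{1}muN1 -muE EE measureU.
  by rewrite -(fineK mu1fin) -EFinD => -[] h; congr EFin; lra.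
(* Used for both atoms: intersecting with [A] keeps the whole mass of [r] or none of it. *)
have mu_pt (r : R) : mu [set r] = 2^-1%:E ->
    mu (A `&` [set r]) = (2^-1%:E * (\1_A r)%:E)%E.
  move=> mur; rewrite indicE; have [rA|rA] := boolP (r \in A).
    by rewrite mule1 -mur setIidr// => x /= ->; exact/set_mem.
  rewrite mule0 (_ : _ `&` _ = set0) ?measure0//; apply/seteqP; split=> x //=.
  by case=> Ax xr; move: rA; rewrite -xr mem_set.
have muEC : mu (~` E) = 0%E.
  by rewrite probability_setC// [X in (_ - X)%E]muE subee.
have muAC : mu (A `&` ~` E) = 0%E.
  apply: (subset_measure0 _ _ (@subIsetr _ A (~` E))).
  - by apply: measurableI => //; exact: measurableC.
  - exact: measurableC.
  - exact: muEC.
have muAE : mu (A `&` E) = rademacher R A.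
  rewrite rademacherE EE setIUr measureU.
  - by congr (_ + _)%E; apply: mu_pt => //; rewrite muN1.
  - exact: measurableI.
  - exact: measurableI.
  - by rewrite setIACA disj setI0.
(* Splitting [A] along [E] and its complement leaves only the two atoms, the rest being null. *)
rewrite -[in LHS](setIT A) -(setvU E) setIUr measureU.
- by rewrite [X in (X + _)%E]muAC add0e.
- by apply: measurableI => //; exact: measurableC.
- exact: measurableI.
- by rewrite setIACA setICl setI0.
Qed.

Theorem proposition1p15 (R : realType)
    (mu : probability (measurableTypeR R) R) (hmu : symmetric_measure mu) :
  (0 <= boolean_fisher_info mu)%E /\
  (boolean_fisher_info mu = 0%E <->
   forall A : set (measurableTypeR R), measurable A -> mu A = rademacher R A).
Proof.
split.
  rewrite boolean_fisher_infoE; apply: integral_ge0 => z _.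
  exact: boolean_fisher_gap_ge0.
rewrite boolean_fisher_info_eq0; split; first exact: symmetric_measure_sqr_eq1.
(* For the converse, the equality of measures is tested on the set [x^2 = 1], which contains both
   atoms. *)
move=> ->; last exact: measurable_sqr_eq1.
rewrite rademacherE !indicE !mem_set /= ?sqrrN ?expr1n// !mule1.
by rewrite -EFinD -[2^-1]mul1r -splitr.
Qed.
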